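(* Let $k$ be a positive integer, $\tau>0$, and let $u_i^0\in H_0^1(\Omega)$, $i\in[k]$, be the initial data. For $n\ge0$ let $u_i^{n+1}$, $i\in[k]$, be computed from $u_i^n$, $i\in[k]$, by the following three-step operator splitting algorithm: (1) (diffusion step) $\tilde u_i^{n+1}=e^{\tau\Delta}u_i^n$; (2) (positivity- and orthogonality-preserving step) pointwise in $\Omega$, by one of the following two rules (the same rule being used at all steps): (first type) $$\hat u_i^{n+1}=\begin{cases}\tilde u_i^{n+1}-\max_{j\in[k],j\ne i}\{\tilde u_j^{n+1}\},&\text{if }\tilde u_i^{n+1}>0\text{ and }\tilde u_i^{n+1}>\max_{j\in[k],j\ne i}\{\tilde u_j^{n+1}\},\\0,&\text{otherwise};\end{cases}$$ (second type) $$\hat u_i^{n+1}=\begin{cases}\tilde u_i^{n+1}-\Big(\tilde u_i^{n+1}\max_{\ell\in[k],\ell\ne i}\{\tilde u_\ell^{n+1}\}\Big)^{1/2},&\text{if }\tilde u_i^{n+1}>0\text{ and }i=\min\{\arg\max_{\ell\in[k]}\tilde u_\ell^{n+1}\},\\0,&\text{otherwise};\end{cases}$$ (3) (norm-preserving step) $u_i^{n+1}=\hat u_i^{n+1}/\|\hat u_i^{n+1}\|$. Then, for both the first-type and the second-type algorithm, $$u_i^{n+1}\ge0,\qquad\|u_i^{n+1}\|=1,\qquad u_i^{n+1}u_j^{n+1}=0,\qquad i\in[k],\ \forall j\in[k],\ j\ne i.$$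
   Context: $\Omega\subset\mathbb{R}^d$ is a given bounded smooth domain, $[k]=\{1,\dots,k\}$, and $\|\cdot\|$ is the $L^2(\Omega)$ norm. $e^{\tau\Delta}$ is the solution operator at time $\tau$ of the heat equation $\partial_tv=\Delta v$ on $\Omega$ with the chosen (periodic, Dirichlet or Neumann) boundary conditions. At each point $x\in\Omega$, $\arg\max_{\ell\in[k]}\tilde u_\ell^{n+1}$ denotes the set of indices at which the maximum of $\tilde u_\ell^{n+1}(x)$ over $\ell$ is attained. Identities and inequalities between functions are pointwise in $\Omega$. *)

(* Defs.v *)
From HB Require Import structures.
From mathcomp Require Import all_boot all_order all_algebra.
From mathcomp Require Import all_classical all_reals all_analysis.

Set Implicit Arguments.
Unset Strict Implicit.
Unset Printing Implicit Defensive.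

Import Order.TTheory GRing.Theory Num.Theory.
Import numFieldNormedType.Exports.

Local Open Scope classical_set_scope.
Local Open Scope ring_scope.

Section lebesgue_rV.
Variable R : realType.

Definition lebesgue_R :
    {sigma_finite_measure set (measurableTypeR R) -> \bar R} :=
  @lebesgue_measure R.

(* The sigma-algebra generated by the coordinates: the Borel sets of R^n. *)
Section sigma_algebra.
Variable n : nat.

Definition rV_coord (i : 'I_n) (x : 'rV[R]_n) : measurableTypeR R := x ord0 i.

Let mrV0 : g_sigma_preimage rV_coord set0.
Proof. exact: sigma_algebra0. Qed.

Let mrVC A : g_sigma_preimage rV_coord A -> g_sigma_preimage rV_coord (~` A).
Proof. exact: sigma_algebraC. Qed.

Let mrV_bigcup (F : (set 'rV[R]_n)^nat) :
  (forall i, g_sigma_preimage rV_coord (F i)) ->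
  g_sigma_preimage rV_coord (\bigcup_i F i).
Proof. exact: sigma_algebra_bigcup. Qed.

HB.instance Definition _ := @isMeasurable.Build default_measure_display
  'rV[R]_n (g_sigma_preimage rV_coord) mrV0 mrVC mrV_bigcup.

End sigma_algebra.

Lemma measurable_rV_coord n (i : 'I_n) : measurable_fun setT (@rV_coord n i).
Proof.
move=> _ Y mY; rewrite setTI; apply: sub_sigma_algebra => /=.
rewrite -bigcup_seq/=; exists i => /=; first by rewrite mem_index_enum.
by exists Y => //; rewrite setTI.
Qed.

Lemma measurable_fun_rV d (T : measurableType d) n (f : T -> 'rV[R]_n) :
  (forall i, measurable_fun setT (@rV_coord n i \o f)) ->
  measurable_fun setT f.
Proof.
move=> mf _ A; rewrite setTI.
suff: @measurable _ 'rV[R]_n `<=` [set B | measurable (f @^-1` B)] by exact.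
apply: smallest_sub.
  split=> /=; first by rewrite preimage_set0.
  - by move=> B; rewrite setTD -preimage_setC => /measurableC.
  - by move=> F mF; rewrite preimage_bigcup; exact: bigcup_measurable.
move=> B; rewrite -bigcup_seq/= => -[i _ [Y mY <-]].
by rewrite setTI /= -[X in measurable X]setTI; exact: mf.
Qed.

Definition rV_cons n (p : measurableTypeR R * 'rV[R]_n) : 'rV[R]_n.+1 :=
  \row_i (if unlift ord0 i is Some j then p.2 ord0 j else p.1).

Definition rV_uncons n (x : 'rV[R]_n.+1) : measurableTypeR R * 'rV[R]_n :=
  (x ord0 ord0, \row_i x ord0 (lift ord0 i)).

Lemma rV_consK n : cancel (@rV_cons n) (@rV_uncons n).
Proof.
move=> [a x]; congr pair; first by rewrite mxE unlift_none.
by apply/rowP => i; rewrite !mxE liftK.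
Qed.

Lemma measurable_rV_cons n : measurable_fun setT (@rV_cons n).
Proof.
apply: measurable_fun_rV => i; case: (unliftP ord0 i) => [j|] ->.
  rewrite (_ : _ \o _ = rV_coord j \o snd).
    exact: measurableT_comp (@measurable_rV_coord n j) measurable_snd.
  by apply/funext => p; rewrite /rV_coord /= mxE liftK.
rewrite (_ : _ \o _ = fst) //.
by apply/funext => p; rewrite /rV_coord /= mxE unlift_none.
Qed.

Lemma measurable_rV_uncons n : measurable_fun setT (@rV_uncons n).
Proof.
apply: measurable_fun_pair; first exact: (@measurable_rV_coord n.+1 ord0).
apply: measurable_fun_rV => i.
rewrite (_ : _ \o _ = rV_coord (lift ord0 i)); first exact: measurable_rV_coord.
by apply/funext => x; rewrite /rV_coord /= mxE.
Qed.

Section step.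
Variables (n : nat) (mu : {sigma_finite_measure set 'rV[R]_n -> \bar R}).
Local Open Scope ereal_scope.

Definition lebesgue_rV_step : set 'rV[R]_n.+1 -> \bar R :=
  pushforward (lebesgue_R \x mu) (@rV_cons n).

Let step0 : lebesgue_rV_step set0 = 0.
Proof. by rewrite /lebesgue_rV_step /pushforward preimage_set0 measure0. Qed.

Let step_ge0 A : 0 <= lebesgue_rV_step A.
Proof. exact: (measure_ge0 (lebesgue_R \x mu)). Qed.

Let step_additive : semi_sigma_additive lebesgue_rV_step.
Proof.
move=> F mF tF mUF; rewrite /lebesgue_rV_step /pushforward preimage_bigcup.
have mcF i : measurable (@rV_cons n @^-1` F i).
  by rewrite -[X in measurable X]setTI; exact: measurable_rV_cons.
apply: measure_semi_sigma_additive => //; last exact: bigcup_measurable.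
apply/trivIsetP => i j _ _ ij; rewrite -preimage_setI.
by move/trivIsetP : tF => /(_ _ _ _ _ ij) ->//; rewrite preimage_set0.
Qed.

HB.instance Definition _ := isMeasure.Build _ _ _
  lebesgue_rV_step step0 step_ge0 step_additive.

Let step_sigma_finite : sigma_finite setT lebesgue_rV_step.
Proof.
have /sigma_finiteP[F [TF ndF Foo]] := sigma_finiteT lebesgue_R.
have /sigma_finiteP[G [TG ndG Goo]] := sigma_finiteT mu.
exists (fun i => @rV_uncons n @^-1` (F i `*` G i)).
  rewrite -preimage_bigcup (_ : \bigcup_i _ = setT) ?preimage_setT//.
  apply/seteqP; split => // -[a x] _.
  have [i _ Fia] : (\bigcup_i F i) a by rewrite -TF.
  have [j _ Gjx] : (\bigcup_i G i) x by rewrite -TG.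
  exists (maxn i j) => //; split => /=.
    by move: a Fia; exact/subsetPset/ndF/leq_maxl.
  by move: x Gjx; exact/subsetPset/ndG/leq_maxr.
move=> k; have [? ?] := Foo k; have [? ?] := Goo k; split.
  by rewrite -[X in measurable X]setTI; apply: measurable_rV_uncons => //;
     exact: measurableX.
rewrite /lebesgue_rV_step /pushforward -comp_preimage.
rewrite (_ : _ \o _ = id) ?preimage_id; last first.
  by apply/funext => p /=; rewrite rV_consK.
by rewrite product_measure1E// lte_mul_pinfty// ge0_fin_numE.
Qed.

HB.instance Definition _ := Measure_isSigmaFinite.Build _ _ _
  lebesgue_rV_step step_sigma_finite.

End step.

Fixpoint lebesgue_rV n : {sigma_finite_measure set 'rV[R]_n -> \bar R} :=
  if n is m.+1 then lebesgue_rV_step (lebesgue_rV m)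
  else \d_(0 : 'rV[R]_0).

Lemma measurable_rV_box n (A : 'I_n -> set (measurableTypeR R)) :
  (forall i, measurable (A i)) ->
  measurable [set x : 'rV[R]_n | forall i, A i (x ord0 i)].
Proof.
move=> mA; rewrite (_ : mkset _ =
    \big[setI/setT]_(i < n) (@rV_coord n i @^-1` A i)).
  apply: bigsetI_measurable => i _; rewrite -[X in measurable X]setTI.
  exact: measurable_rV_coord.
rewrite -bigcap_seq; apply/seteqP; split=> x /= H i.
  by move=> _; exact: H.
by have := H i; apply; rewrite /= mem_index_enum.
Qed.

Lemma lebesgue_rV_box n (A : 'I_n -> set (measurableTypeR R)) :
  (forall i, measurable (A i)) ->
  lebesgue_rV n [set x | forall i, A i (x ord0 i)] =
  (\prod_(i < n) @lebesgue_measure R (A i))%E.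
Proof.
elim: n A => [|n IH] A mA.
  by rewrite big_ord0 /= diracE mem_set// => -[].
rewrite big_ord_recl -IH//= /lebesgue_rV_step /pushforward.
rewrite -product_measure1E//; last first.
  by apply: (@measurable_rV_box n (A \o lift ord0)) => i; exact: mA.
apply: (congr1 (lebesgue_R \x lebesgue_rV n)%E); apply/seteqP; split=> [[a x] /= H|[a x] /= [Aa H] i].
  split; first by have := H ord0; rewrite mxE unlift_none.
  by move=> i; have := H (lift ord0 i); rewrite mxE liftK.
by rewrite mxE; case: unliftP => [j|] ->; rewrite ?mxE.
Qed.

End lebesgue_rV.

Section smoothness.
Variables (R : realType) (V : normedModType R).
Implicit Types (U C : set V) (f : V -> R).

Definition iter_derive (s : seq V) f : V -> R :=
  foldr (fun v g => 'D_v g) f s.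

(* C^oo on the open set U: all the iterated directional derivatives exist and
   are continuous *)
Definition smooth_on U f := forall (s : seq V) (p : V), U p ->
  {for p, continuous (iter_derive s f)} /\
  forall v, derivable (iter_derive s f) p v.

(* C^oo on the open set U, all derivatives having limits at the points of C,
   where U `<=` C `<=` closure U *)
Definition smooth_up_to U C f := smooth_on U f /\
  forall (s : seq V) (p : V), C p ->
    cvg (iter_derive s f q @[q --> within U (nbhs p)]).

End smoothness.

Section function_spaces.
Variables (R : realType) (d : nat).
Implicit Types (Omega : set 'rV[R]_d) (f g u phi : 'rV[R]_d -> R).

Definition e_ (j : 'I_d) : 'rV[R]_d := delta_mx ord0 j.

(* Functions on Omega are represented by functions on R^d whose values outside
   Omega are irrelevant. *)
Definition L2norm Omega f : \bar R :=
  ('N[lebesgue_rV R d]_2%:E [EFin \o (f \_ Omega)])%E.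

Definition L2 Omega f : Prop :=
  measurable_fun setT (f \_ Omega) /\ (L2norm Omega f < +oo)%E.

Definition norm2 Omega f : R := fine (L2norm Omega f).

Definition test_function Omega phi : Prop :=
  smooth_on setT phi /\
  exists K, [/\ compact K, K `<=` Omega & forall x, ~ K x -> phi x = 0].

Definition weak_partial Omega (j : 'I_d) u g : Prop :=
  forall phi, test_function Omega phi ->
    (\int[lebesgue_rV R d]_(x in Omega) (u x * 'D_(e_ j) phi x))%R =
    - (\int[lebesgue_rV R d]_(x in Omega) (g x * phi x))%R.

(* H^1_0(Omega): the closure in H^1(Omega) of the test functions on Omega *)
Definition H10 Omega u : Prop :=
  L2 Omega u /\
  exists Du : 'I_d -> 'rV[R]_d -> R,
    (forall j, L2 Omega (Du j) /\ weak_partial Omega j u (Du j)) /\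
    exists phi : nat -> 'rV[R]_d -> R,
      [/\ forall m, test_function Omega (phi m),
          L2norm Omega (phi m \- u) @[m --> \oo] --> 0%E &
          forall j, L2norm Omega ('D_(e_ j) (phi m) \- Du j) @[m --> \oo]
                      --> 0%E].

End function_spaces.

Section domains.
Variables (R : realType) (d : nat).
Implicit Types (Omega U : set 'rV[R]_d) (p nu : 'rV[R]_d).

Definition boundary Omega := closure Omega `\` interior Omega.

Definition local_defining_function Omega p U (rho : 'rV[R]_d -> R) : Prop :=
  [/\ open U, U p, smooth_on U rho,
      forall x, U x -> (Omega x <-> rho x < 0) &
      exists j, 'D_(e_ R j) rho p != 0].

Definition smooth_bounded_domain Omega : Prop :=
  [/\ open Omega, connected Omega, Omega !=set0, bounded_set Omega &
      forall p, boundary Omega p ->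
        exists U rho, local_defining_function Omega p U rho].

(* nu is the outward unit normal at the boundary point p: the normalized
   gradient of a function defining Omega near p *)
Definition outward_normal Omega p nu : Prop :=
  exists U rho, local_defining_function Omega p U rho /\
    nu = (Num.sqrt (\sum_j ('D_(e_ R j) rho p) ^+ 2))^-1 *:
         \row_j 'D_(e_ R j) rho p.

Definition open_box (a b : 'rV[R]_d) : set 'rV[R]_d :=
  [set x | forall j, a ord0 j < x ord0 j < b ord0 j].

End domains.

(* Periodic boundary conditions identify the opposite faces of the box with
   corners a and b. *)
Inductive boundary_condition (R : realType) (d : nat) :=
  | Dirichlet
  | Neumann
  | Periodic of 'rV[R]_d & 'rV[R]_d.

Section heat.
Variables (R : realType) (d : nat).
Implicit Types (bc : boundary_condition R d) (Omega : set 'rV[R]_d).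
Implicit Types (u w : 'rV[R]_d -> R) (v : R * 'rV[R]_d -> R).

Definition admissible_domain bc Omega : Prop :=
  if bc is Periodic a b then
    (forall j, a ord0 j < b ord0 j) /\ Omega = open_box a b
  else smooth_bounded_domain Omega.

Definition positive_time (A : set 'rV[R]_d) : set (R * 'rV[R]_d) :=
  [set q | 0 < q.1 /\ A q.2].

Definition dt v : R * 'rV[R]_d -> R := 'D_(1, 0) v.
Definition dx (j : 'I_d) v : R * 'rV[R]_d -> R := 'D_(0, e_ R j) v.

Definition satisfies_bc bc Omega v : Prop :=
  match bc with
  | Dirichlet =>
      smooth_up_to (positive_time Omega) (positive_time (closure Omega)) v /\
      forall t p, 0 < t -> boundary Omega p ->
        v (t, x) @[x --> within Omega (nbhs p)] --> (0 : R)
  | Neumann =>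
      smooth_up_to (positive_time Omega) (positive_time (closure Omega)) v /\
      forall t p nu, 0 < t -> boundary Omega p -> outward_normal Omega p nu ->
        'D_(0, nu) v (t, x) @[x --> within Omega (nbhs p)] --> (0 : R)
  | Periodic a b =>
      smooth_on (positive_time setT) v /\
      forall t x j, 0 < t ->
        v (t, x + (b ord0 j - a ord0 j) *: e_ R j) = v (t, x)
  end.

(* Classical solution, smooth for t > 0 up to the boundary: this regularity
   holds for every initial value in L^2 and makes the solution unique.
   v is the solution for t > 0 of the heat equation on Omega with initial
   value u, attained in L^2(Omega) *)
Definition heat_solution bc Omega u v : Prop :=
  [/\ forall t x, 0 < t -> Omega x ->
        dt v (t, x) = \sum_j dx j (dx j v) (t, x),
      satisfies_bc bc Omega v,
      forall t, 0 < t -> L2 Omega (fun x => v (t, x)) &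
      L2norm Omega (fun x => v (t, x) - u x) @[t --> 0^'+] --> 0%E].

(* w = e^{tau Delta} u on Omega; w is the smooth representative *)
Definition heat_operator bc Omega (tau : R) u w : Prop :=
  exists v, heat_solution bc Omega u v /\ forall x, Omega x -> w x = v (tau, x).

End heat.

Inductive projection_type := FirstType | SecondType.

Section projection.
Variables (R : realType) (k : nat).
Implicit Types (y : 'I_k -> R) (i : 'I_k).

(* The maximum of y j over j != i; for k = 1 there is no such j and the value
   is 0, so that both projections give the positive part. *)
Definition max_others y i : R :=
  if [pick j | j != i] is Some j0
  then \big[Num.max/y j0]_(j | j != i) y j else 0.

Definition argmax y : {set 'I_k} := [set l | [forall j, y j <= y l]].

Definition is_least (A : {set 'I_k}) i : bool :=
  (i \in A) && [forall l in A, (i <= l)%N].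

(* For the second type Num.sqrt is 0 on negative numbers; this matters only
   when y i is the unique positive value and all the others are negative. *)
Definition project (rule : projection_type) y i : R :=
  match rule with
  | FirstType =>
      if (0 < y i) && (max_others y i < y i) then y i - max_others y i else 0
  | SecondType =>
      if (0 < y i) && is_least (argmax y) i
      then y i - Num.sqrt (y i * max_others y i) else 0
  end.

End projection.

(* One step u |-> u' of the algorithm, with intermediate functions ut (after
   diffusion) and uh (after projection). Dividing by the norm of uh i
   presupposes that it is not 0. *)
Definition splitting_step (R : realType) (d k : nat)
    (bc : boundary_condition R d) (Omega : set 'rV[R]_d) (tau : R)
    (rule : projection_type) (u ut uh u' : 'I_k -> 'rV[R]_d -> R) : Prop :=
  [/\ forall i, heat_operator bc Omega tau (u i) (ut i),
      forall i x, Omega x -> uh i x = project rule (ut ^~ x) i,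
      forall i, norm2 Omega (uh i) != 0 &
      forall i x, Omega x -> u' i x = uh i x / norm2 Omega (uh i)].

(* Main.v *)
Require Import Defs.
From mathcomp Require Import all_boot all_order all_algebra.
From mathcomp Require Import all_classical all_reals all_analysis.

Set Implicit Arguments.
Unset Strict Implicit.
Unset Printing Implicit Defensive.

Import Order.TTheory GRing.Theory Num.Theory.
Import numFieldNormedType.Exports.

Local Open Scope classical_set_scope.
Local Open Scope ring_scope.

(** Scaling by [c] turns each nonnegative simple function below [f] into one below [c * f], so it
    competes in the supremum on the right. *)
Lemma le_integralZl_pos d (T : measurableType d) (R : realType)
    (mu : {measure set T -> \bar R}) (f : T -> \bar R) (c : R) : 0 < c ->
  (forall x, 0 <= f x)%E ->
  (c%:E * \int[mu]_x f x <= \int[mu]_x (c%:E * f x))%E.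
Proof.
move=> c0 f0.
have cf0 x : (0 <= c%:E * f x)%E by rewrite mule_ge0// lee_fin ltW.
rewrite !ge0_integralTE// muleC -lee_pdivlMr//; apply: ge_ereal_sup => _ [h hf <-].
rewrite lee_pdivlMr// muleC -sintegralrM; apply: ereal_sup_ubound.
exists (scale_nnsfun h (ltW c0)) => // x /=.
by rewrite EFinM lee_pmul2l.
Qed.

(* The integral of a nonnegative function is a supremum over simple functions,
   whether or not the function is measurable, so that no regularity of the
   projected functions has to be established. *)
Lemma integralZl_pos d (T : measurableType d) (R : realType)
    (mu : {measure set T -> \bar R}) (f : T -> \bar R) (c : R) : 0 < c ->
  (forall x, 0 <= f x)%E ->
  (\int[mu]_x (c%:E * f x) = c%:E * \int[mu]_x f x)%E.
Proof.
move=> c0 f0; apply/eqP; rewrite eq_le le_integralZl_pos// andbT.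
have cf0 x : (0 <= c%:E * f x)%E by rewrite mule_ge0// lee_fin ltW.
have ci0 : 0 < c^-1 by rewrite invr_gt0.
(* The reverse inequality is the same bound applied to the function [c * f] and the factor
   [c^-1]. *)
have := le_integralZl_pos mu ci0 cf0.
under [X in (_ <= X)%E -> _]eq_integral => x _.
  rewrite muleA -EFinM mulVf ?gt_eqF// mul1e; over.
by rewrite muleC lee_pdivrMr// muleC.
Qed.

Lemma norm2_ge0 (R : realType) (d : nat) (Omega : set 'rV[R]_d) f :
  0 <= norm2 Omega f.
Proof. by rewrite /norm2 fine_ge0// Lnorm_ge0. Qed.

(** The algorithm prescribes its functions only on [Omega], so norms must be comparable from
    equality there. *)
Lemma eq_norm2 (R : realType) (d : nat) (Omega : set 'rV[R]_d) f g :
  (forall x, Omega x -> f x = g x) -> norm2 Omega f = norm2 Omega g.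
Proof.
move=> fg; congr fine; apply: eq_Lnorm => x /=; congr EFin.
by rewrite !patchE; case: ifPn => // /set_mem /fg.
Qed.

Lemma norm2Z (R : realType) (d : nat) (Omega : set 'rV[R]_d) f (c : R) :
  0 < c -> norm2 Omega (fun x => c * f x) = c * norm2 Omega f.
Proof.
move=> c0; rewrite /norm2 /L2norm unlock.
under eq_integral => x _.
  rewrite (_ : (_ `^ 2)%E = ((c `^ 2)%:E * `|(f \_ Omega) x|%:E `^ 2)%E).
    over.
  rewrite /= !patchE; case: ifPn => _; last first.
    by rewrite normr0 powR0// mule0.
  by rewrite normrM (gtr0_norm c0) powRM// ltW.
rewrite integralZl_pos ?powR_gt0//; last by move=> x; rewrite lee_fin powR_ge0.
rewrite poweRM ?integral_ge0// ?lee_fin ?powR_ge0//=.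
rewrite -powRrM mulfV// powRr1 ?ltW//.
(* If the norm is infinite, [fine] sends both sides to 0. *)
set I := (_ `^ 2^-1)%E; case: I => //=; first by rewrite gt0_muley ?lte_fin// mulr0.
by rewrite gt0_muleNy ?lte_fin// mulr0.
Qed.

Section projection.
Variables (R : realType) (k : nat).
Implicit Types (y : 'I_k -> R) (i j : 'I_k).

Lemma le_max_others y i j : j != i -> y j <= max_others y i.
Proof.
rewrite /max_others => ji; case: pickP => [j0 _|/(_ j)]; last by rewrite ji.
exact: le_bigmax_cond.
Qed.

Lemma max_others_argmax y i : i \in argmax y -> 0 < y i ->
  max_others y i <= y i.
Proof.
rewrite inE /max_others => /forallP yi y0.
(* Without another index [max_others] is 0, and the bound is the positivity of [y i]. *)
case: pickP => [j0 _|_]; last exact: ltW.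
exact: bigmax_le.
Qed.

Lemma project_ge0 rule y i : 0 <= project rule y i.
Proof.
case: rule => /=; case: ifP => // /andP[y0].
  by move=> lt_y; rewrite subr_ge0 ltW.
case/andP => /max_others_argmax /(_ y0) le_y _.
(* With [y i] written as the root of its square, monotonicity of [Num.sqrt] suffices; it covers a
   negative product too, whose root is 0. *)
rewrite subr_ge0 -[leRHS](gtr0_norm y0) -sqrtr_sqr.
by rewrite ler_wsqrtr// expr2 ler_wpM2l// ltW.
Qed.

(** At most one component survives: the first rule keeps only a strict maximum, the second only the
    least index of the argmax. *)
Lemma project_orthogonal rule y i j : j != i ->
  project rule y i * project rule y j = 0.
Proof.
move=> ji; case: rule => /=.
  case: ifP => [/andP[_ lti]|]; last by rewrite mul0r.
  case: ifP => [/andP[_ ltj]|]; last by rewrite mulr0.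
  have ij : i != j by rewrite eq_sym.
  (* Two strict maxima would give [y j < y i < y j]. *)
  have := lt_trans (le_lt_trans (le_max_others y ji) lti)
                   (le_lt_trans (le_max_others y ij) ltj).
  by rewrite ltxx.
case: ifP => [/and3P[_ mi /forall_inP li]|]; last by rewrite mul0r.
case: ifP => [/and3P[_ mj /forall_inP lj]|]; last by rewrite mulr0.
by move: ji; rewrite -val_eqE/= eqn_leq li// lj.
Qed.

End projection.

Theorem theorem3p5 (R : realType) (d k : nat) (bc : boundary_condition R d)
    (Omega : set 'rV[R]_d) (tau : R) (rule : projection_type)
    (u ut uh : nat -> 'I_k -> 'rV[R]_d -> R) (n : nat) :
  (0 < d)%N -> (0 < k)%N -> admissible_domain bc Omega -> 0 < tau ->
  (forall i, H10 Omega (u 0%N i)) ->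
  (forall m, (m <= n)%N ->
     splitting_step bc Omega tau rule (u m) (ut m.+1) (uh m.+1) (u m.+1)) ->
  forall i : 'I_k,
    [/\ forall x, Omega x -> 0 <= u n.+1 i x,
        norm2 Omega (u n.+1 i) = 1 &
        forall j : 'I_k, j != i ->
          forall x, Omega x -> u n.+1 i x * u n.+1 j x = 0].
Proof.
move=> _ _ _ _ _ /(_ n (leqnn n)) [_ uhE N0 uE] i.
(* As [fine] of an infinite value is 0, a nonzero [norm2] is also a finite norm, so the division is
   a genuine normalization. *)
have Npos j : 0 < norm2 Omega (uh n.+1 j) by rewrite lt_neqAle eq_sym N0 norm2_ge0.
split=> [x Ox||j ji x Ox].
- by rewrite uE// uhE// divr_ge0 ?project_ge0// ltW.
- rewrite (eq_norm2 (g := fun x => (norm2 Omega (uh n.+1 i))^-1 * uh n.+1 i x)).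
    by rewrite norm2Z ?invr_gt0// mulVf.
  by move=> x Ox; rewrite uE// mulrC.
- by rewrite !uE// !uhE// mulrACA project_orthogonal// mul0r.
Qed.
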